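(* Let $n\ge 1$ and ${\boldsymbol{a}}_0\in\mathbb{R}_{>0}^n$. Then the deformation cone of $\operatorname{Tes}_n({\boldsymbol{a}}_0)$ with respect to $(L_n,-P_n)$ is \[\operatorname{Def}(\operatorname{Tes}_n({\boldsymbol{a}}_0))=\{({\boldsymbol{a}},\tilde{{\boldsymbol{b}}})\in\mathbb{R}^n\times\widetilde{\mathbb{U}}(n)\;:\;\eta_i(\tilde{{\boldsymbol{b}}})\ge -a_i\text{ for all }1\le i\le n-1\},\] where $a_i$ is the $i$-th coordinate of ${\boldsymbol{a}}$. Moreover, every deformation of $\operatorname{Tes}_n({\boldsymbol{a}}_0)$ is a translation of a Tesler polytope, i.e. of the form $\operatorname{Tes}_n({\boldsymbol{a}}')+\boldsymbol{t}$ for some ${\boldsymbol{a}}'\in\mathbb{R}^n_{\ge0}$ and $\boldsymbol{t}\in\mathbb{U}(n)$.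
   Context: $\mathbb{U}(n)$ is the real vector space of upper triangular $n\times n$ real matrices $\boldsymbol{m}=(m_{i,j})_{1\le i\le j\le n}$. For $1\le i\le n$ the $i$-th hook sum is $\eta_i(\boldsymbol{m})=m_{i,i}+\sum_{i<j\le n}m_{i,j}-\sum_{1\le j<i}m_{j,i}$, and $\boldsymbol{\eta}(\boldsymbol{m})=(\eta_1(\boldsymbol{m}),\dots,\eta_n(\boldsymbol{m}))$. For ${\boldsymbol{a}}\in\mathbb{R}^n_{\ge0}$ the Tesler polytope is $\operatorname{Tes}_n({\boldsymbol{a}})=\{\boldsymbol{m}\in\mathbb{U}(n):\boldsymbol{\eta}(\boldsymbol{m})={\boldsymbol{a}},\ m_{i,j}\ge0\ \text{for all }1\le i\le j\le n\}$. Let $L_n:\mathbb{U}(n)\to\mathbb{R}^n$ be the linear map $\boldsymbol{m}\mapsto\boldsymbol{\eta}(\boldsymbol{m})$. Let $\widetilde{\mathbb{U}}(n)$ be the space of real arrays $\tilde{{\boldsymbol{b}}}=(\tilde b_{i,j})$ indexed by pairs $1\le i\le j\le n$ with $(i,j)\ne(n,n)$, and $P_n:\mathbb{U}(n)\to\widetilde{\mathbb{U}}(n)$ the projection forgetting the $(n,n)$ entry. For $1\le i\le n-1$ and $\tilde{{\boldsymbol{b}}}\in\widetilde{\mathbb{U}}(n)$, put $\eta_i(\tilde{{\boldsymbol{b}}})=\tilde b_{i,i}+\sum_{i<j\le n}\tilde b_{i,j}-\sum_{1\le j<i}\tilde b_{j,i}$. For $({\boldsymbol{a}},\tilde{{\boldsymbol{b}}})\in\mathbb{R}^n\times\widetilde{\mathbb{U}}(n)$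 let $Q({\boldsymbol{a}},\tilde{{\boldsymbol{b}}})=\{\boldsymbol{m}\in\mathbb{U}(n):L_n\boldsymbol{m}={\boldsymbol{a}},\ -P_n\boldsymbol{m}\le\tilde{{\boldsymbol{b}}}\}$, i.e. $\boldsymbol{\eta}(\boldsymbol{m})={\boldsymbol{a}}$ and $m_{i,j}\ge-\tilde b_{i,j}$ for all $(i,j)\neq(n,n)$. For ${\boldsymbol{a}}_0\in\mathbb{R}^n_{>0}$, the description $L_n\boldsymbol{m}={\boldsymbol{a}}_0$, $-P_n\boldsymbol{m}\le\boldsymbol{0}$ is a minimal description of $\operatorname{Tes}_n({\boldsymbol{a}}_0)$ (the equations define its affine span and each inequality $m_{i,j}\ge0$, $(i,j)\ne(n,n)$, defines a distinct facet). Deformation: a polytope $Q\subset\mathbb{U}(n)$ is a deformation of $\operatorname{Tes}_n({\boldsymbol{a}}_0)$ with deforming vector $({\boldsymbol{a}},\tilde{{\boldsymbol{b}}})$ (with respect to $(L_n,-P_n)$) if (1) $Q=Q({\boldsymbol{a}},\tilde{{\boldsymbol{b}}})$ and this description is tight, i.e. for every $(i,j)\ne(n,n)$ some point of $Q$ satisfies $m_{i,j}=-\tilde b_{i,j}$; and (2) for every vertex ${\boldsymbol{v}}$ of $\operatorname{Tes}_n({\boldsymbol{a}}_0)$, the set $Q\cap\{\boldsymbol{m}: m_{i,j}=-\tilde b_{i,j}\text{ for all }(i,j)\ne(n,n)\text{ with }v_{i,j}=0\}$ is a single vertex of $Q$. (Equivalently, $Q$ is a deformation iff the normal fan of $\operatorname{Tes}_n({\boldsymbol{a}}_0)$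 refines that of $Q$.) The deformation cone $\operatorname{Def}(\operatorname{Tes}_n({\boldsymbol{a}}_0))$ is the set of all deforming vectors. *)

(* Defs.v *)
From HB Require Import structures.
From mathcomp Require Import all_boot all_order all_algebra.
From mathcomp Require Import boolp classical_sets reals.

Set Implicit Arguments.
Unset Strict Implicit.
Unset Printing Implicit Defensive.

Import Order.TTheory GRing.Theory Num.Theory.

Local Open Scope ring_scope.
Local Open Scope classical_set_scope.

(* Indices are 0-based, so the pair (n, n) is the one with both components n.-1. *)

Definition upper_pair (n : nat) (p : 'I_n * 'I_n) : bool := (p.1 <= p.2)%N.

Definition last_pair (n : nat) (p : 'I_n * 'I_n) : bool :=
  ((p.1 : nat).+1 == n) && ((p.2 : nat).+1 == n).

Definition upper_pair' (n : nat) (p : 'I_n * 'I_n) : bool :=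
  upper_pair p && ~~ last_pair p.

(* R^o gives the space of arrays its R-module structure. *)
Definition array (R : realType) (n : nat) (D : pred ('I_n * 'I_n)) :=
  {ffun {p : 'I_n * 'I_n | D p} -> R^o}.

Notation U R n := (array R (@upper_pair n)).
Notation Ut R n := (array R (@upper_pair' n)).

(* Entries outside the index set D read as 0. *)
Definition entry (R : realType) (n : nat) (D : pred ('I_n * 'I_n))
    (m : array R D) (i j : 'I_n) : R :=
  if insub (i, j) is Some p then m p else 0.

(* Used both on U(n) and, for rows other than the last, on U~(n): such a hook
   does not contain the pair (n, n), so only genuine entries of the array
   occur in it. *)
Definition hook (R : realType) (n : nat) (D : pred ('I_n * 'I_n))
    (m : array R D) (i : 'I_n) : R :=
  entry m i i + \sum_(j < n | (i < j)%N) entry m i j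
              - \sum_(j < n | (j < i)%N) entry m j i.

Definition Ln (R : realType) (n : nat) (m : U R n) : 'rV[R]_n :=
  \row_(i < n) hook m i.

Definition Pn (R : realType) (n : nat) (m : U R n) : Ut R n :=
  [ffun p => entry m (val p).1 (val p).2].

Definition Tes (R : realType) (n : nat) (a : 'rV[R]_n) : set (U R n) :=
  [set m | Ln m = a /\ forall p, (0 : R) <= m p].

Definition Qset (R : realType) (n : nat) (a : 'rV[R]_n) (b : Ut R n) :
    set (U R n) :=
  [set m | Ln m = a /\ forall p, - (Pn m p : R) <= b p].

Definition polyhedron (R : realType) (V : lmodType R) (Q : set V) : Prop :=
  exists (I : finType) (f : I -> {scalar V}) (d : I -> R),
    Q = [set x | forall i, f i x <= d i].

Definition polytope (R : realType) (n : nat) (Q : set (U R n)) : Prop :=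
  polyhedron Q /\ exists M : R, forall m, Q m -> forall p, `|m p : R| <= M.

Definition face (R : realType) (V : lmodType R) (Q F : set V) : Prop :=
  exists (f : {scalar V}) (d : R),
    (forall x, Q x -> f x <= d) /\ F = Q `&` [set x | f x = d].

Definition vertex (R : realType) (V : lmodType R) (Q : set V) (v : V) : Prop :=
  face Q [set v].

Definition tight (R : realType) (n : nat) (a : 'rV[R]_n) (b : Ut R n) : Prop :=
  forall p, exists2 m, Qset a b m & Pn m p = - (b p : R).

Definition deformation_with (R : realType) (n : nat) (a0 : 'rV[R]_n)
    (Q : set (U R n)) (ab : 'rV[R]_n * Ut R n) : Prop :=
  [/\ polytope Q,
      Q = Qset ab.1 ab.2,
      tight ab.1 ab.2
    & forall v, vertex (Tes a0) v ->
        exists2 w, vertex Q w &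
          Q `&` [set m | forall p, Pn v p = 0 :> R -> Pn m p = - (ab.2 p : R)] = [set w]].

Definition deformation (R : realType) (n : nat) (a0 : 'rV[R]_n)
    (Q : set (U R n)) : Prop :=
  exists ab, deformation_with a0 Q ab.

Definition DefCone (R : realType) (n : nat) (a0 : 'rV[R]_n) :
    set ('rV[R]_n * Ut R n) :=
  [set ab | exists Q, deformation_with a0 Q ab].

(* Main.v *)
Require Import Defs.
From HB Require Import structures.
From mathcomp Require Import all_boot all_order all_algebra.
From mathcomp Require Import boolp classical_sets reals.

(** A choice function [c] on rows with [i <= c i] supports exactly one upper
    triangular matrix with a given hook vector, found by solving for the rows
    from top to bottom.  For [a0 > 0] the vertices of [Tes a0] are exactly these
    matrices.  Subtracting from [Q(a, b)] the matrix with entries [- b] turns the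
    constraints into nonnegativity and the hook vector into [a' i = a i + hook b i]
    for every row but the last; the free corner entry can be chosen so that
    the last coordinate of [a'] is zero, and the missing inequality in that corner
    then follows from the last hook equation.  So if [a' >= 0] then [Q(a, b)] is a
    translate of [Tes a'], and the matrices supported by the various [c] give
    both the tightness and the vertices of [Q(a, b)].  Conversely the
    diagonal vertex of [Tes a0] forces [a' >= 0]. *)

Set Implicit Arguments.
Unset Strict Implicit.
Unset Printing Implicit Defensive.

Import Order.TTheory GRing.Theory Num.Theory.

Local Open Scope ring_scope.
Local Open Scope classical_set_scope.

(** [face] and [polyhedron] ask for bundled linear forms; the forms needed below are given by
    explicit formulas. *)
Lemma scalar_pack (R : realType) (V : lmodType R) (h : V -> R) :
  scalar h -> {f : {scalar V} | f =1 h}.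
Proof.
move=> H; pose f : {scalar V} := HB.pack h (GRing.isLinear.Build _ _ _ _ h H).
by exists f.
Qed.

(** * Entries and hooks as linear forms *)

Section Arrays.
Variables (R : realType) (n : nat).
Implicit Types (i j k : 'I_n) (m x y : U R n) (a : 'rV[R]_n) (b : Ut R n).

Lemma entry_linear (D : pred ('I_n * 'I_n)) i j :
  scalar (fun m : array R D => entry m i j).
Proof.
move=> c u v; rewrite /entry; case: insubP => [p _ _|_]; first by rewrite !ffunE.
by rewrite mulr0 addr0.
Qed.

Lemma entryD (D : pred ('I_n * 'I_n)) (u v : array R D) i j :
  entry (u + v) i j = entry u i j + entry v i j.
Proof. by have := entry_linear i j 1 u v; rewrite scale1r mul1r. Qed.

Lemma entryB (D : pred ('I_n * 'I_n)) (u v : array R D) i j :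
  entry (u - v) i j = entry u i j - entry v i j.
Proof. by rewrite -(scaleN1r v) addrC entry_linear mulN1r addrC. Qed.

Lemma entry_out (D : pred ('I_n * 'I_n)) (m : array R D) i j :
  ~~ D (i, j) -> entry m i j = 0.
Proof. by move=> H; rewrite /entry insubN. Qed.

Lemma entryE (D : pred ('I_n * 'I_n)) (m : array R D) (p : {p | D p}) :
  entry m (val p).1 (val p).2 = m p.
Proof. by rewrite /entry -surjective_pairing valK. Qed.

Lemma entry_ext x y :
  (forall i j, (i <= j)%N -> entry x i j = entry y i j) -> x = y.
Proof.
move=> H; apply/ffunP => p; rewrite -[x p]entryE -[y p]entryE.
by apply: H; have := valP p.
Qed.

Definition upper_of (g : 'I_n -> 'I_n -> R) : U R n :=
  [ffun p => g (val p).1 (val p).2].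

Lemma entry_upper_of g i j : (i <= j)%N -> entry (upper_of g) i j = g i j.
Proof. by move=> H; rewrite /entry insubT ffunE. Qed.

Lemma PnE m (p : {p | @upper_pair' n p}) :
  Pn m p = entry m (val p).1 (val p).2.
Proof. by rewrite ffunE. Qed.

Lemma hookE (D : pred ('I_n * 'I_n)) (m : array R D) i :
  hook m i = \sum_(j < n | (i <= j)%N) entry m i j - \sum_(j < n | (j < i)%N) entry m j i.
Proof.
congr (_ - _); rewrite [RHS](bigD1 i) //=; congr (_ + _).
by apply: eq_bigl => j; rewrite ltn_neqAle andbC eq_sym.
Qed.

Lemma hook_linear (D : pred ('I_n * 'I_n)) i :
  scalar (fun m : array R D => hook m i).
Proof.
move=> c u v; rewrite !hookE mulrBr addrACA -opprD !mulr_sumr -!big_split /=.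
by congr (_ - _); apply: eq_bigr => j _; rewrite entry_linear.
Qed.

Lemma LnD x y : Ln (x + y) = Ln x + Ln y.
Proof.
apply/rowP => i; rewrite !mxE.
by have := hook_linear i 1 x y; rewrite scale1r mul1r.
Qed.

Lemma LnZ c x : Ln (c *: x) = c *: Ln x.
Proof.
apply/rowP => i; rewrite !mxE.
have := hook_linear i c x 0; rewrite addr0 => ->.
rewrite [hook 0 i]hookE !big1 ?subr0 ?addr0 //;
  by move=> j _; rewrite /entry; case: insub => // p; rewrite ffunE.
Qed.

Lemma LnB x y : Ln (x - y) = Ln x - Ln y.
Proof. by rewrite -!scaleN1r LnD LnZ. Qed.

Lemma TesP a m :
  Tes a m <-> Ln m = a /\ forall i j, 0 <= entry m i j.
Proof.
split=> -[ha H]; split=> //.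
  by move=> i j; rewrite /entry; case: insub.
by move=> p; rewrite -[m p]entryE.
Qed.

(** * Matrices supported on a choice function *)

Lemma ord_strong_ind (P : 'I_n -> Prop) :
  (forall i, (forall j, (j < i)%N -> P j) -> P i) -> forall i, P i.
Proof.
move=> H i; have [k] := ubnP (i : nat); elim: k i => // k IH i ik.
by apply: H => j ji; apply: IH; apply: leq_trans ji _.
Qed.

(** Row [i] depends on earlier rows only, so iterating the right-hand side from zero stabilises
    there after [i.+1] steps; [n] iterations settle all rows. *)
Lemma triangular_recursion (a : 'I_n -> R) (e : rel 'I_n) :
  (forall i, 0 <= a i) ->
  exists r : 'I_n -> R, (forall i, 0 <= r i) /\
    forall i, r i = a i + \sum_(j < n | (j < i)%N && e j i) r j.
Proof.
move=> a0; pose F (r : 'I_n -> R) i := a i + \sum_(j < n | (j < i)%N && e j i) r j.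
exists (iter n F (fun=> 0)); split.
  suff H (k : nat) i : 0 <= iter k F (fun=> 0) i by move=> i; apply: H.
  by elim: k i => //= k IH i; rewrite /F addr_ge0 ?sumr_ge0.
suff H (k : nat) i : (i < k)%N -> iter k F (fun=> 0) i = iter k.+1 F (fun=> 0) i.
  by move=> i; rewrite {1}H.
elim: k i => // k IH i ik /=; congr (_ + _); apply: eq_bigr => j /andP[ji _].
by apply: IH; apply: leq_trans ji _.
Qed.

(** The hook equation read as conservation of flow: what leaves row [i] is its input plus what
    arrives from earlier rows. *)
Lemma row_sum m i :
  \sum_(j < n | (i <= j)%N) entry m i j =
  Ln m ord0 i + \sum_(j < n | (j < i)%N) entry m j i.
Proof. by rewrite mxE hookE subrK. Qed.

(** Entries on the graph of [c] may vanish too, as can happen when the hook vector has zero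
    coordinates. *)
Definition supported (c : 'I_n -> 'I_n) m :=
  forall i j, j != c i -> entry m i j = 0.

(** Once the earlier rows agree, [row_sum] fixes the total of row [i], which is its entry in column
    [c i]. *)
Lemma supported_inj (c : 'I_n -> 'I_n) x y :
  (forall i, (i <= c i)%N) ->
  supported c x -> supported c y -> Ln x = Ln y -> x = y.
Proof.
move=> ic sx sy xy; apply: entry_ext => i j ij.
elim/ord_strong_ind: i j ij => i IH j ij.
have [->|jc] := eqVneq j (c i); last by rewrite sx ?sy.
have rs m : supported c m -> \sum_(k < n | (i <= k)%N) entry m i k = entry m i (c i).
  by move=> sm; rewrite (bigD1 (c i)) //= big1 ?addr0 // => k /andP[_ /sm].
rewrite -rs // -(rs y) // !row_sum xy; congr (_ + _).
by apply: eq_bigr => k ki; rewrite IH // ltnW.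
Qed.

(** Each row [i] sends its whole total [r i] to column [c i], so the totals obey the recursion whose
    edges are [c j == i]. *)
Lemma supported_flow (c : 'I_n -> 'I_n) a :
  (forall i, (i <= c i)%N) -> (forall i, 0 <= a ord0 i) ->
  exists2 m, Tes a m & supported c m.
Proof.
move=> ic a0; have [r [r0 rE]] := triangular_recursion (fun j i => c j == i) a0.
pose m := upper_of (fun i j => if j == c i then r i else 0).
have mE i j : entry m i j = if j == c i then r i else 0.
  have [ij|ij] := leqP i j; first by rewrite entry_upper_of.
  rewrite entry_out -?ltnNge //; case: eqP => // jc.
  by have := ic i; rewrite -jc leqNgt ij.
exists m; last by move=> i j /negbTE jc; rewrite mE jc.
apply/TesP; split; last by move=> i j; rewrite mE; case: ifP.
apply/rowP => i; rewrite mxE hookE (bigD1 (c i)) //= mE eqxx big1 ?addr0.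
  rewrite (eq_bigr (fun j => if c j == i then r j else 0)).
    by rewrite -big_mkcondr /= rE addrK.
  by move=> j _; rewrite mE eq_sym.
by move=> j /andP[_ /negbTE jc]; rewrite mE jc.
Qed.

(** * Boundedness and vertices of Tesler polytopes *)

Lemma Tes_bounded a : (forall i, 0 <= a ord0 i) ->
  exists M : R, forall m, Tes a m -> forall i j, entry m i j <= M.
Proof.
(* With every earlier row feeding row [i], the recursion gives a bound on each entry of row [i]. *)
move=> a0; have [r [r0 rE]] := triangular_recursion (fun _ _ => true) a0.
exists (\sum_i r i) => m /TesP[mE m0] i j.
suff mr : forall i j, entry m i j <= r i.
  by apply: le_trans (mr i j) _; rewrite (bigD1 i) //= lerDl sumr_ge0.
move=> {}i {}j; elim/ord_strong_ind: i j => i IH j.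
have [ij|ji] := leqP i j; last by rewrite entry_out ?r0 // -ltnNge.
have : entry m i j <= \sum_(k < n | (i <= k)%N) entry m i k.
  by rewrite (bigD1 j) //= lerDl sumr_ge0.
move=> /le_trans; apply; rewrite row_sum mE rE lerD2l.
rewrite [leRHS](eq_bigl (fun j : 'I_n => (j < i)%N)); last by move=> k; rewrite andbT.
by apply: ler_sum => k ki; apply: IH.
Qed.

(** By [row_sum] each row total is at least [a ord0 i], hence positive. *)
Lemma Tes_row_support a m : (forall i, 0 < a ord0 i) -> Tes a m ->
  exists c : 'I_n -> 'I_n, forall i, (i <= c i)%N /\ 0 < entry m i (c i).
Proof.
move=> a0 /TesP[mE m0].
suff H i : exists k, (i <= k)%N /\ 0 < entry m i k by have [c] := choice H; exists c.
apply: contrapT => N.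
have : 0 < \sum_(j < n | (i <= j)%N) entry m i j.
  by rewrite row_sum mE ltr_wpDr // sumr_ge0.
rewrite big1 ?ltxx // => k ik; apply/eqP; rewrite eq_le m0 andbT leNgt.
by apply/negP => H; apply: N; exists k.
Qed.

Lemma vertex_supported a v : (forall i, 0 < a ord0 i) ->
  vertex (Tes a) v ->
  exists c : 'I_n -> 'I_n, [/\ forall i, (i <= c i)%N,
    forall i, 0 < entry v i (c i) & supported c v].
Proof.
move=> a0 [f [d [fd fv]]].
have [vT fvd] : Tes a v /\ f v = d.
  by have : (Tes a `&` [set x | f x = d]) v by rewrite -fv.
have [c cP] := Tes_row_support a0 vT.
have ic i := (cP i).1; have c0 i := (cP i).2.
have [w wT wc] : exists2 w, Tes a w & supported c w.
  by apply: supported_flow => // i; rewrite ltW.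
suff vw : v = w by exists c; split=> //; rewrite vw.
have /TesP[vE v0] := vT; have /TesP[wE w0] := wT.
(* Since [w] vanishes wherever [v] does, [v + e (v - w)] is in [Tes a] for
   small [e > 0]; as [f] is maximal at [v], it is then constant along the
   line through [v] and [w]. *)
have [e e0 eP] : exists2 e : R, 0 < e & forall i, e * entry w i (c i) <= entry v i (c i).
  (* The summand 1 keeps the denominator positive when [w] vanishes at [(i, c i)], and still
     [g i * entry w i (c i) <= entry v i (c i)]. *)
  pose g i := entry v i (c i) / (1 + entry w i (c i)).
  have w1 i : 0 < 1 + entry w i (c i) by rewrite ltr_wpDr.
  exists (\big[Num.min/1]_i g i).
    by apply: lt_bigmin => // i _; rewrite divr_gt0.
  move=> i; have g0 : 0 <= g i by rewrite ltW // divr_gt0.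
  apply: (@le_trans _ _ (g i * entry w i (c i))).
    by rewrite ler_wpM2r // bigmin_le_cond.
  rewrite /g -mulrA ler_piMr ?ler_pdivrMl //.
  by rewrite mulr1 lerDr.
have zT : Tes a (v + e *: (v - w)).
  apply/TesP; split; first by rewrite LnD LnZ LnB vE wE subrr scaler0 addr0.
  move=> i j; rewrite addrC entry_linear entryB.
  have [->|jc] := eqVneq j (c i).
    rewrite mulrBr addrAC subr_ge0 (le_trans (eP i)) // lerDr.
    by rewrite mulr_ge0 // ltW.
  by rewrite wc // subr0 addr_ge0 ?mulr_ge0 // ltW.
have fw : f w = d.
  apply: le_anti; rewrite fd //=.
  have := fd _ zT; rewrite linearD linearZ linearB /= fvd gerDl pmulr_rle0 //.
  by rewrite subr_le0.
by have : [set v] w by rewrite fv.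
Qed.

Lemma supported_vertex (c : 'I_n -> 'I_n) a v :
  (forall i, (i <= c i)%N) -> Tes a v -> supported c v -> vertex (Tes a) v.
Proof.
move=> ic vT vc; have /TesP[vE v0] := vT.
(* Minus the total mass off the graph of [c]: at most 0 on the polytope, and 0 exactly at the
   matrices supported on [c]. *)
pose h m : R := - \sum_i \sum_(j | j != c i) entry m i j.
have hl : scalar h.
  move=> e x y; rewrite /h mulrN -opprD; congr (- _).
  rewrite mulr_sumr -big_split; apply: eq_bigr => i _ /=.
  rewrite mulr_sumr -big_split; apply: eq_bigr => j _ /=.
  exact: entry_linear.
have [f fE] := scalar_pack hl; exists f, 0; split.
  move=> x /TesP[_ x0]; rewrite fE oppr_le0 sumr_ge0 // => i _.
  by rewrite sumr_ge0.
apply/seteqP; split=> x /=.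
  move=> ->; split=> //; rewrite fE /h big1 ?oppr0 // => i _.
  by rewrite big1 // => j; exact: vc.
move=> [/TesP[xE x0] /eqP]; rewrite fE oppr_eq0 => /eqP hx.
apply: (@supported_inj c) => //; last by rewrite xE vE.
move=> i j jc.
have /psumr_eq0P/(_ i isT) := hx => /(_ (fun i _ => sumr_ge0 _ (fun j _ => x0 i j))).
by move=> /psumr_eq0P; apply.
Qed.

(** * [Qset a b] as a translated Tesler polytope *)

Lemma polyhedron_Qset a b : polyhedron (Qset a b).
Proof.
(* Each hook equation is encoded by two opposite inequalities. *)
pose I : finType := ('I_n + 'I_n + {p | @upper_pair' n p})%type.
pose h (s : I) m : R := match s with
  | inl (inl i) => hook m i
  | inl (inr i) => -1 * hook m i
  | inr p => -1 * entry m (val p).1 (val p).2 end.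
have hl s : scalar (h s).
  by case: s => [[i|i]|p] e x y /=; rewrite ?hook_linear ?entry_linear // mulrDr mulrCA.
pose d (s : I) : R := match s with
  | inl (inl i) => a ord0 i | inl (inr i) => - a ord0 i | inr p => b p end.
exists I, (fun s => sval (scalar_pack (hl s))), d.
apply/seteqP; split=> m /=.
  move=> [mE mb] s; case: scalar_pack => f /= ->.
  by case: s => [[i|i]|p] /=; rewrite -?mE ?mxE ?mulN1r // -PnE.
move=> H; have {}H s : h s m <= d s.
  by have := H s; case: scalar_pack => f /= ->.
split.
  apply/rowP => i; apply: le_anti; rewrite mxE (H (inl (inl i))) /=.
  by have := H (inl (inr i)); rewrite /= mulN1r lerN2.
by move=> p; have := H (inr p); rewrite /= mulN1r PnE.
Qed.

Lemma last_pair_lt i j : (i < j)%N -> ~~ last_pair (i, j).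
Proof.
move=> ij; apply/negP => /andP[/eqP /= il /eqP /= jl].
by move: ij; rewrite (succn_inj (etrans il (esym jl))) ltnn.
Qed.

(** The corner value is the one for which the last hook equals the last coordinate of [a], given
    that the entries above it are those of [- b]. *)
Definition shift a b : U R n :=
  upper_of (fun i j =>
    if last_pair (i, j) then a ord0 i - \sum_(k < n | (k < i)%N) entry b k i
    else - entry b i j).

Lemma entry_shift a b i j : (i <= j)%N -> ~~ last_pair (i, j) ->
  entry (shift a b) i j = - entry b i j.
Proof. by move=> ij l; rewrite entry_upper_of // (negbTE l). Qed.

Lemma hook_shift a b i : (i.+1 < n)%N -> hook (shift a b) i = - hook b i.
Proof.
move=> ni; rewrite !hookE opprD -!sumrN; congr (_ + _).
  apply: eq_bigr => j ij; rewrite entry_shift //.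
  by rewrite /last_pair /= ltn_eqF.
by apply: eq_bigr => j ji; rewrite entry_shift ?(ltnW ji) ?last_pair_lt.
Qed.

Lemma last_row_sum m i : i.+1 = n -> \sum_(j < n | (i <= j)%N) entry m i j = entry m i i.
Proof.
move=> il; rewrite (bigD1 i) //= big1 ?addr0 // => j /andP[ij]; case/eqP.
by apply/val_inj/eqP; rewrite /= eqn_leq ij andbT -ltnS il.
Qed.

Lemma hook_shift_last a b i : i.+1 = n -> hook (shift a b) i = a ord0 i.
Proof.
move=> il; rewrite hookE last_row_sum // entry_upper_of // /last_pair /= il eqxx /=.
rewrite [X in _ - X](eq_bigr (fun j => - entry b j i)) ?sumrN ?opprK ?subrK // => j ji.
by rewrite entry_shift ?(ltnW ji) ?last_pair_lt.
Qed.

Lemma QsetP a b m :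
  Qset a b m <-> Ln m = a /\ forall i j, (i <= j)%N -> ~~ last_pair (i, j) ->
    - entry b i j <= entry m i j.
Proof.
split=> -[mE mb]; split=> //.
  move=> i j ij l; have D : upper_pair' (i, j) by apply/andP.
  by have := mb (Sub (i, j) D); rewrite PnE -[b _]entryE lerNl.
move=> p; have /andP[u l] := valP p; rewrite PnE -[b p]entryE lerNl.
by apply: mb => //; rewrite -surjective_pairing.
Qed.

Lemma Qset_shift a b : (forall i, (i.+1 < n)%N -> - a ord0 i <= hook b i) ->
  let a' := a - Ln (shift a b) in
  (forall i, 0 <= a' ord0 i) /\ Qset a b = [set m + shift a b | m in Tes a'].
Proof.
move=> ab a'.
have a'0 i : 0 <= a' ord0 i.
  rewrite !mxE; have [ni|ni] := ltnP i.+1 n.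
    by rewrite hook_shift // opprK addrC -lerBlDr sub0r ab.
  rewrite hook_shift_last ?subrr //; apply/eqP; rewrite eqn_leq ni andbT.
  exact: ltn_ord.
split=> //; apply/seteqP; split=> m /=.
  move=> /QsetP[mE mb]; exists (m - shift a b); last by rewrite subrK.
  have LE : Ln (m - shift a b) = a' by rewrite LnB mE.
  have N i j : ~~ last_pair (i, j) -> 0 <= entry (m - shift a b) i j.
    have [ij|ij] := leqP i j; last by rewrite entry_out // -ltnNge.
    by move=> l; rewrite entryB entry_shift // subr_ge0 mb.
  (* The corner is the only entry of its row, so [row_sum] writes it as a sum of nonnegative
     terms. *)
  apply/TesP; split=> // i j; have [l|] := boolP (last_pair (i, j)); last exact: N.
  have /andP[/eqP /= il /eqP /= jl] := l.
  have {j jl l}<- : i = j by apply/val_inj/succn_inj; rewrite il jl.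
  have := row_sum (m - shift a b) i; rewrite LE last_row_sum // => ->.
  rewrite addr_ge0 // sumr_ge0 // => j ji; apply: N.
  exact: last_pair_lt.
move=> [x /TesP[xE x0] <-]; apply/QsetP; split; first by rewrite LnD xE subrK.
by move=> i j ij l; rewrite entryD entry_shift // lerDr.
Qed.

Lemma vertex_translate (Q : set (U R n)) v t :
  vertex Q v -> vertex [set m + t | m in Q] (v + t).
Proof.
move=> [f [d [fd fv]]]; exists f, (d + f t); split.
  by move=> _ [m Qm <-]; rewrite linearD lerD2r fd.
apply/seteqP; split=> x /=.
  have [Qv fvd] : (Q `&` [set x | f x = d]) v by rewrite -fv.
  by move=> ->; split; [exists v | rewrite linearD fvd].
move=> [[m Qm <-]]; rewrite linearD => /addIr fm; congr (_ + _).
by have : [set v] m by rewrite fv.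
Qed.

(** * The two inclusions for the deformation cone *)

Lemma deformation_cone_le (a0 : 'rV[R]_n) a b Q : (forall i, 0 < a0 ord0 i) ->
  deformation_with a0 Q (a, b) ->
  forall i, (i.+1 < n)%N -> - a ord0 i <= hook b i.
Proof.
(* The diagonal matrix [v] with diagonal [a0] is a vertex of [Tes a0], and
   the point of [Q] it is matched with has all its off-diagonal constraints
   tight, so its [i]-th diagonal constraint is the inequality to be proved. *)
move=> a0p [_ /= QE _ vQ] i ni.
have [v vT vd] : exists2 v, Tes a0 v & supported id v.
  by apply: supported_flow => // k; rewrite ltW.
have [w _ wE] := vQ v (supported_vertex (c := id) (fun k => leqnn _) vT vd).
have [Qw wb] : (Q `&` [set m | forall p, Pn v p = 0 :> R -> Pn m p = - (b p : R)]) w.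
  by rewrite wE.
move: Qw; rewrite QE => /QsetP[<- mb].
have off k j : (k < j)%N -> entry w k j = - entry b k j.
  move=> kj; have D : upper_pair' (k, j).
    by rewrite /upper_pair' /upper_pair ltnW ?last_pair_lt.
  have := wb (Sub (k, j) D); rewrite !PnE -[b _]entryE; apply.
  by apply: vd; rewrite /= -val_eqE /= gtn_eqF.
rewrite mxE /hook (eq_bigr _ (fun j => off i j)) (eq_bigr _ (fun j => off j i)).
rewrite !sumrN opprK !opprD opprK lerD2r lerD2r lerNl mb //.
by rewrite /last_pair /= ltn_eqF.
Qed.

Lemma deformation_cone_ge (a0 : 'rV[R]_n) a b : (forall i, 0 < a0 ord0 i) ->
  (forall i, (i.+1 < n)%N -> - a ord0 i <= hook b i) ->
  deformation_with a0 (Qset a b) (a, b).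
Proof.
move=> a0p ab; have [a'0 QE] := Qset_shift ab.
set t := shift a b in a'0 QE; set a' := a - Ln t in a'0 QE.
have PnDt x (p : {p | @upper_pair' n p}) :
    Pn (x + t) p = entry x (val p).1 (val p).2 - b p.
  have /andP[u l] := valP p; by rewrite PnE entryD entry_shift ?(entryE b p).
split=> //=.
- split; first exact: polyhedron_Qset.
  have [M Mx] := Tes_bounded a'0; exists (M + \sum_p `|t p : R|) => m.
  rewrite QE => -[x xT <-] p; rewrite ffunE (le_trans (ler_normD _ _)) //.
  rewrite lerD //; last by rewrite (bigD1 p) //= lerDl sumr_ge0.
  by rewrite ger0_norm ?(xT.2 p) // -[x p]entryE Mx.
- move=> p; have /andP[u l] := valP p.
  case: (val p) u l (PnDt^~ p) => i j /= ij l PnDtp.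
  (* Sending row [i] to a column [k] other than [j] makes entry [(i, j)] vanish. For [j = i] the
     next column serves; it exists because [(i, i)] is not the corner. *)
  have [k [ik jk]] : exists k : 'I_n, (i <= k)%N /\ j != k.
    have [jE|ji] := eqVneq j i; last by exists i.
    have ni : (i.+1 < n)%N.
      rewrite ltn_neqAle ltn_ord andbT; apply: contra l.
      by rewrite /last_pair jE /= andbb.
    by exists (Ordinal ni); split=> //=; rewrite jE -val_eqE /= ltn_eqF.
  have [|x xT xc] := @supported_flow (fun s => if s == i then k else s) a' _ a'0.
    by move=> s; case: eqP => // ->.
  exists (x + t); first by rewrite QE; exists x.
  by rewrite PnDtp xc ?eqxx // sub0r.
(* The upper triangular zeros of [v] are exactly the positions off the graph of [c], so the
   prescribed equalities cut out the translates of the points of [Tes a'] supported on [c], of which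
   there is one. *)
- move=> v /(vertex_supported a0p)[c [ic c0 vc]].
  have [x xT xc] := supported_flow ic a'0.
  exists (x + t); first by rewrite QE; apply/vertex_translate/supported_vertex/xc.
  rewrite QE; apply/seteqP; split=> m /=.
    move=> [[y /TesP[yE y0] <-] yv]; congr (_ + _).
    apply: (@supported_inj c) => //; last by rewrite yE xT.1.
    move=> i j jc; have [ij|ij] := leqP i j; last by rewrite entry_out // -ltnNge.
    have D : upper_pair' (i, j).
      (* The corner carries no constraint but always lies on the graph, since [i <= c i] forces the
         last row to choose it. *)
      apply/andP; split=> //; apply: contra jc => /andP[/= /eqP il /eqP jl].
      have ji : (j : nat) = i by apply/succn_inj; rewrite il jl.
      by rewrite -val_eqE /= eqn_leq {1}ji ic /= -ltnS jl.
    have := yv (Sub (i, j) D); rewrite PnDt PnE /= => /(_ (vc _ _ jc)).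
    by move=> /eqP; rewrite subr_eq addrC subrr => /eqP.
  move=> ->; split; first by exists x.
  move=> p; rewrite PnDt PnE; case: (val p) => i j /= vij.
  rewrite xc ?sub0r //; apply/eqP => jc.
  by have := c0 i; rewrite -jc vij ltxx.
Qed.

End Arrays.

Theorem theorem1p1 (R : realType) (n : nat) (hn : (1 <= n)%N)
    (a0 : 'rV[R]_n) (ha0 : forall i : 'I_n, 0 < a0 ord0 i) :
  DefCone a0 =
    [set ab : 'rV[R]_n * Ut R n |
      forall i : 'I_n, ((i : nat).+1 < n)%N -> hook ab.2 i >= - ab.1 ord0 i]
  /\
  (forall Q : set (U R n), deformation a0 Q ->
     exists (a' : 'rV[R]_n) (t : U R n),
       (forall i : 'I_n, 0 <= a' ord0 i) /\
       Q = [set m + t | m in Tes a']).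
Proof.
split.
  apply/seteqP; split=> -[a b] /=.
    by move=> [Q] /(deformation_cone_le ha0).
  by move=> ab; exists (Qset a b); apply: deformation_cone_ge.
move=> Q [[a b] abQ]; have [a'0 QE] := Qset_shift (deformation_cone_le ha0 abQ).
exists (a - Ln (shift a b)), (shift a b); split=> //.
by case: abQ => _ -> _ _.
Qed.
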